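(* Let $q$ be a power of an odd prime and let $\mathrm{N}:\mathbb F_{q^3}\to\mathbb F_q$, $\mathrm{N}(z)=z^{1+q+q^2}$, be the norm function. For $a,b\in\mathbb F_{q^3}^*$, the function $x\mapsto x^{q^2+1}+ax^{q+1}+bx^2$ is planar on $\mathbb F_{q^3}$ if and only if at least one of the following holds: (i) $a=b^{q+1}$ and $\mathrm{N}(b)\ne1$; or (ii) $\mathrm{N}(a)-2ab^{q^2}+1=0$ and $\mathrm{N}(a)^2\ne1$.
   Context: $\mathbb F_{q^3}$ is the finite field with $q^3$ elements, an extension of $\mathbb F_q$ of degree $3$, with $q$ odd; $\mathbb F_{q^3}^*$ is its set of nonzero elements. A function $f:\mathbb F_{q^3}\to\mathbb F_{q^3}$ is called planar on $\mathbb F_{q^3}$ if for every $c\in\mathbb F_{q^3}^*$ the map $x\mapsto f(x+c)-f(x)$ is a permutation of $\mathbb F_{q^3}$. *)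

(* Defs.v *)
From mathcomp Require Import all_boot all_algebra all_field.

Set Implicit Arguments.
Unset Strict Implicit.
Unset Printing Implicit Defensive.

Import GRing.Theory.
Local Open Scope ring_scope.

Definition planar (F : finFieldType) (f : F -> F) : Prop :=
  forall c : F, c != 0 -> bijective (fun x : F => f (x + c) - f x).

(* When #|F| = q ^ 3, this is the norm of F over its subfield of order q,
   with values in that subfield but regarded as elements of F. *)
Definition norm3 (F : finFieldType) (q : nat) (z : F) : F :=
  z ^+ (1 + q + q ^ 2).

(* Main.v *)
Require Import Defs.
From mathcomp Require Import all_boot all_algebra all_field.
From mathcomp Require Import fingroup cyclic.
From mathcomp Require Import mpoly zify ring.
Import GRing.Theory.
Local Open Scope ring_scope.

(** The conjugates of x over the subfield K of order q are written X = x,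
    Y = x^q, Z = x^(q^2); a', a'' and b', b'' are the conjugates of a and b.
    The function is the quadratic form f = XZ + aXY + bX^2, with polarization
    B(x, c) = f(x + c) - f(x) - f(c), so it is planar exactly when the
    K-bilinear map B has no zero divisors ([planar_anisotropic]).

    Sufficiency comes from an explicit linear change of variable m.  Under (i),
    with m = Z + bX + bb'Y, one has (N(b) - 1) f = b' m m'' - m m', so f is
    linearly equivalent to x^(q+1); under (ii), with m = X + aa'Y + a'Z, one
    has 2a'(1 - N(a)) f = m^2 - a'^2 m''^2, so f is linearly equivalent to x^2.
    The norm condition is what makes these linear maps invertible.

    Necessity uses only power sums.  If B has no zero divisors, f(x) is never
    l f(y) with l a nonsquare of K and y nonzero
    ([square_not_proportional]); as f takes each nonzero value of its image
    exactly twice, at x and -x, it follows that f on one half of the field and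
    l f on the other half together form a permutation.  Hence
    sum f(x)^e = sum x^e for every multiple e of q - 1
    ([sum_trinomial_expf]), and this vanishes when 0 < e < q^3 - 1.

    On the other side, f^i f'^j f''^h is a form in X, Y, Z.  If its degree is
    4(q - 1), its sum over the field involves only the coefficients of
    X^(2q-1) Y^(q-2) Z^(q-1) and the two monomials obtained from it by cyclic
    shifts ([sum_frob_monomial]).  Two choices of exponents suffice.

    - (q - 1, q - 1, 0) gives a geometric sum in w = b'/(aa'), which vanishes
      only if w lies in K and w <> 1 ([anisotropic_ratio]).  Then
      s = ab'' = a'b lies in K, and w = s / N(a).
    - (q - 1, q - 2, 1) gives derivatives of geometric sums
      ([anisotropic_relation]).  Once evaluated, the relation excludes s = 1
      and otherwise reads (sw - 1)((2s - 1)w - s) = 0.  The first factor says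
      N(a) = s^2, that is a = bb' with N(b) = s; the second says
      N(a) = 2s - 1. *)

(** * Exponents divisible by q^3 - 1 *)

(** Dividing by q - 1, the condition becomes
    j + 4 + (q + 1) l = d (q^2 + q + 1) with d = 1, 2 or 3.  With e = d q - l
    this is j + 4 = e (q + 1) + d, and the degree bound forces e + d <= 3. *)
Lemma dvdn_digits (q i j l : nat) : (2 < q)%N -> (i + j + l = 4 * q.-1)%N ->
  ((q ^ 3).-1 %| i + q * j + q ^ 2 * l)%N =
  [|| [&& i == (2 * q).-1, j == q.-2 & l == q.-1],
      [&& i == q.-1, j == (2 * q).-1 & l == q.-2]
    | [&& i == q.-2, j == q.-1 & l == (2 * q).-1]].
Proof.
move=> q2 ijl; have [r qr r1] : exists2 r, q = r.+1 & (1 < r)%N.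
  by exists q.-1; lia.
have -> : (q ^ 3).-1 = (r * (q ^ 2 + q + 1))%N by rewrite qr !expnS expn0; nia.
have -> : (i + q * j + q ^ 2 * l = r * (4 + j + l * (q + 1)))%N.
  by rewrite qr in ijl *; rewrite !expnS expn0; nia.
rewrite dvdn_pmul2l; last lia.
apply/idP/idP => [/dvdnP[d hd]|]; last first.
  by case/or3P => /and3P[_ /eqP -> /eqP ->]; apply/dvdnP;
    [exists 1%N|exists 1%N|exists 2%N]; rewrite qr !expnS expn0; nia.
rewrite !expnS expn0 muln1 in hd.
have d0 : (0 < d)%N by case: d hd => //; lia.
have d4 : (d < 4)%N.
  by rewrite ltnNge; apply/negP => d4; rewrite qr in hd ijl; nia.
have hl : (l < d * q)%N.
  by rewrite ltnNge; apply/negP => hl; nia.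
have [e le] : exists e, (l + e = d * q)%N by exists (d * q - l)%N; lia.
have hj : (j + 4 = e * (q + 1) + d)%N by nia.
have e0 : (0 < e)%N by lia.
have e3 : (e + d < 4)%N by nia.
have : [|| (e == 1) && (d == 1), (e == 2) && (d == 1) | (e == 1) && (d == 2)]%N.
  by lia.
case/or3P => /andP[/eqP e1 /eqP d1]; subst e d; lia.
Qed.

(** * Power sums over a finite field *)

Lemma expf_card_pred (F : finFieldType) (x : F) : x != 0 -> x ^+ #|F|.-1 = 1.
Proof.
move=> x0; apply: (mulfI x0).
by rewrite mulr1 -exprS prednK ?expf_card // ltnW ?finNzRing_gt1.
Qed.

Lemma card_nonzero (F : finFieldType) : #|[pred x : F | x != 0]| = #|F|.-1.
Proof. by rewrite -(cardsC1 (0 : F)); apply: eq_card => x; rewrite !inE. Qed.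

Lemma exists_expf_neq1 (F : finFieldType) (e : nat) :
  ~~ (#|F|.-1 %| e)%N -> exists2 g : F, g != 0 & g ^+ e != 1.
Proof.
set N := #|F|.-1 => hN.
have N_gt0 : (0 < N)%N.
  by rewrite -ltnS prednK ?(ltnW (finNzRing_gt1 F)) ?finNzRing_gt1.
set r := (e %% N)%N; have r_gt0 : (0 < r)%N by rewrite lt0n.
have expr_r (x : F) : x != 0 -> x ^+ e = x ^+ r.
  move=> x0; rewrite (divn_eq e N) exprD mulnC exprM expf_card_pred //.
  by rewrite expr1n mul1r.
have [/existsP[g /andP[g0 g1]]|/existsPn all1] :=
  boolP [exists g : F, (g != 0) && (g ^+ r != 1)].
  by exists g; rewrite // expr_r.
have := @max_unity_roots F r (enum [pred x : F | x != 0]) r_gt0.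
rewrite enum_uniq -cardE card_nonzero -/N => /(_ _ isT) contra.
suff : (N <= r)%N by rewrite leqNgt ltn_mod N_gt0.
apply: contra; apply/allP => x; rewrite mem_enum inE => x0.
by rewrite unity_rootE; have := all1 x; rewrite x0 /= negbK.
Qed.

Lemma sum_expf (F : finFieldType) (e : nat) : (0 < e)%N ->
  \sum_(x : F) x ^+ e = - (#|F|.-1 %| e)%N%:R.
Proof.
case: e => // e _; case: (boolP (_ %| _)%N) => he; last first.
  have [g g0 g1] := exists_expf_neq1 F e.+1 he.
  have : g ^+ e.+1 * \sum_(x : F) x ^+ e.+1 = \sum_(x : F) x ^+ e.+1.
    rewrite mulr_sumr [RHS](reindex_inj (mulfI g0)) /=.
    by apply: eq_bigr => x _; rewrite exprMn.
  move/eqP; rewrite -subr_eq0 -{2}[\sum_x _]mul1r -mulrBl mulf_eq0 subr_eq0.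
  by rewrite (negPf g1) oppr0 => /eqP.
rewrite (bigD1 0) //= expr0n add0r (eq_bigr (fun=> 1)) => [|x x0]; last first.
  by case/dvdnP: he => d ->; rewrite mulnC exprM expf_card_pred ?expr1n.
rewrite sumr_const card_nonzero; apply/eqP.
rewrite -subr_eq0 opprK -mulrSr prednK ?(ltnW (finNzRing_gt1 F)) //.
have := @expg_cardG F [set: F]%G 1%R (in_setT _).
by rewrite cardsT FinRing.zmodXgE => ->.
Qed.

(** * The Frobenius map of a cubic extension *)

Section CubicExtension.

Variables (F : finFieldType) (p k q : nat).
Hypotheses (hp : prime p) (hodd : odd p) (hk : (0 < k)%N).
Hypotheses (hq : q = (p ^ k)%N) (hF : #|F| = (q ^ 3)%N).

Lemma q_gt2 : (2 < q)%N.
Proof.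
have p3 := odd_prime_gt2 hodd hp.
rewrite hq; apply: leq_trans p3 _.
by rewrite -[leqLHS]expn1 leq_exp2l ?prime_gt1.
Qed.

Lemma q_odd : odd q. Proof. by rewrite hq oddX hodd orbT. Qed.

Lemma p_pchar : p \in [pchar F].
Proof. by apply: (@card_finPcharP _ _ (k * 3)); rewrite // hF hq expnM. Qed.

Lemma natq_eq0 : q%:R = 0 :> F.
Proof.
by apply/eqP; rewrite -(dvdn_pcharf p_pchar) hq -(prednK hk) expnS dvdn_mulr.
Qed.

Lemma two_neq0 : 2%:R != 0 :> F.
Proof.
rewrite -(dvdn_pcharf p_pchar); apply/negP => /dvdn_leq /= h.
by have := odd_prime_gt2 hodd hp; rewrite ltnNge h.
Qed.

Lemma eq_opp_eq0 (x : F) : x = - x -> x = 0.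
Proof.
move/eqP; rewrite -addr_eq0 -mulr2n -mulr_natl mulf_eq0 (negPf two_neq0).
by move/eqP.
Qed.

Definition frob (x : F) : F := x ^+ q.

Lemma frobD x y : frob (x + y) = frob x + frob y.
Proof.
apply: exprDn_pchar; rewrite (eq_pnat _ (pcharf_eq p_pchar)) hq.
by rewrite pnatX pnat_id.
Qed.

Lemma frobM x y : frob (x * y) = frob x * frob y. Proof. exact: exprMn. Qed.

Lemma frobN x : frob (- x) = - frob x.
Proof. by rewrite /frob exprNn -signr_odd q_odd mulN1r. Qed.

Lemma frobB x y : frob (x - y) = frob x - frob y.
Proof. by rewrite frobD frobN. Qed.

Lemma frob0 : frob 0 = 0. Proof. by rewrite /frob expr0n; case: q q_gt2. Qed.

Lemma frob1 : frob 1 = 1. Proof. exact: expr1n. Qed.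

Lemma frobV x : frob x^-1 = (frob x)^-1. Proof. exact: exprVn. Qed.

Lemma frob_nat n : frob n%:R = n%:R.
Proof.
by elim: n => [|n IH]; rewrite ?frob0 // -natr1 frobD IH frob1.
Qed.

Lemma frob3 x : frob (frob (frob x)) = x.
Proof.
by rewrite /frob -!exprM -[RHS]expf_card hF !expnS expn0 muln1 mulnA.
Qed.

Lemma frob_eq0 x : (frob x == 0) = (x == 0).
Proof. by rewrite expf_eq0 (ltn_trans _ q_gt2). Qed.

Lemma norm3E (x : F) : norm3 q x = x * frob x * frob (frob x).
Proof. by rewrite /norm3 /frob !exprD expr1 -exprM mulnn. Qed.

Lemma frob_norm3 (x : F) : frob (norm3 q x) = norm3 q x.
Proof. by rewrite !norm3E !frobM frob3; ring. Qed.

Lemma norm3M (x y : F) : norm3 q (x * y) = norm3 q x * norm3 q y.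
Proof. exact: exprMn. Qed.

Lemma norm3_frob (x : F) : norm3 q (frob x) = norm3 q x.
Proof. by rewrite !norm3E frob3; ring. Qed.

Lemma norm3_eq0 (x : F) : (norm3 q x == 0) = (x == 0).
Proof. by rewrite expf_eq0 add1n addSn. Qed.

Definition fixed_field : {set F} := [set x | frob x == x].

(** 'X^q - 'X divides 'X^(q^3) - 'X, which splits with simple roots over F. *)
Lemma card_fixed_field : #|fixed_field| = q.
Proof.
have q1 : (1 < q)%N := ltn_trans (isT : 1 < 2)%N q_gt2.
pose P : {poly F} := 'X^q - 'X.
have szP : size P = q.+1.
  by rewrite size_polyDl size_polyXn // size_polyN size_polyX.
have rootP x : root P x = (x \in fixed_field).
  by rewrite inE rootE /P !hornerE subr_eq0.
have iterP n : P %| 'X^(q ^ n) - 'X.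
  elim: n => [|n IH]; first by rewrite expn0 expr1 subrr dvdp0.
  rewrite -(subrK ('X^q) ('X^(q ^ n.+1))) -addrA dvdp_add //.
  rewrite expnSr exprM.
  have pP : [pchar {poly F}].-nat q.
    rewrite (eq_pnat _ (pcharf_eq (rmorph_pchar polyC p_pchar))) hq.
    by rewrite pnatX pnat_id.
  have := exprDn_pchar ('X^(q ^ n) - 'X) 'X pP; rewrite subrK => ->.
  by rewrite addrK dvdp_exp ?(ltnW q1).
have := iterP 3; rewrite -hF finField_genPoly => /dvdp_prod_XsubC[m Pm].
have mK x : (x \in mask m (index_enum F)) = (x \in fixed_field).
  by rewrite -rootP (eqp_root Pm) root_prod_XsubC.
have /eqP := eqp_size Pm; rewrite szP size_prod_XsubC eqSS => /eqP ->.
rewrite -(card_uniqP (mask_uniq (index_enum_uniq F) m)).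
exact/esym/eq_card.
Qed.

(** * Bilinear products without zero divisors *)

(** Squaring identifies 1 and -1, so it is not onto the fixed field. *)
Lemma exists_nonsquare :
  exists2 l, l \in fixed_field & forall x, x \in fixed_field -> x ^+ 2 != l.
Proof.
have [/forallP allsq|] := boolP
  [forall l in fixed_field, [exists x in fixed_field, x ^+ 2 == l]]; last first.
  rewrite negb_forall => /existsP[l]; rewrite negb_imply negb_exists.
  case/andP=> lK /forallP h; exists l => // x xK.
  by have := h x; rewrite xK.
have sub : fixed_field \subset [set x ^+ 2 | x in fixed_field].
  apply/subsetP => l lK; have /implyP/(_ lK)/existsP[x /andP[xK /eqP xl]] := allsq l.
  by apply/imsetP; exists x.
have /imset_injP inj : #|[set x ^+ 2 | x in fixed_field]| == #|fixed_field|.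
  by rewrite eqn_leq leq_imset_card subset_leq_card.
have := inj 1 (-1); rewrite !inE frobN frob1 !eqxx sqrrN => /(_ isT isT erefl).
by move/eq_opp_eq0/eqP; rewrite oner_eq0.
Qed.

Section AnisotropicProduct.

Variable B : F -> F -> F.
Hypothesis BC : forall x y, B x y = B y x.
Hypothesis BD : forall x y z, B x (y + z) = B x y + B x z.
Hypothesis BZ : forall l x y, l \in fixed_field -> B x (l * y) = l * B x y.
Hypothesis B0 : forall x y, B x y = 0 -> x = 0 \/ y = 0.

(** If B(x, x) = l B(y, y), then B maps the square of the plane V spanned by x
    and y into the plane W spanned by B(x, y) and B(y, y), and any nonzero v in
    V maps V onto W because l is not a square.  For z outside V, the planes
    B(V, z) and W must meet, as q^4 > q^3; so B(v, z) = B(v, v') for some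
    nonzero v and some v' in V, whence z = v', a contradiction. *)
Lemma square_not_proportional l x y :
    l \in fixed_field -> (forall m, m \in fixed_field -> m ^+ 2 != l) ->
  B x x = l * B y y -> y = 0.
Proof.
move=> lK lNsq hxy; apply/eqP/negPn/negP => y0.
pose K2 := setX fixed_field fixed_field.
have cK2 : #|K2| = (q * q)%N by rewrite cardsX card_fixed_field.
have KD u v : u \in fixed_field -> v \in fixed_field -> u + v \in fixed_field.
  by rewrite !inE frobD => /eqP-> /eqP->.
have KM u v : u \in fixed_field -> v \in fixed_field -> u * v \in fixed_field.
  by rewrite !inE frobM => /eqP-> /eqP->.
have KN u : u \in fixed_field -> - u \in fixed_field.
  by rewrite !inE frobN => /eqP->.
have KV u : u \in fixed_field -> u^-1 \in fixed_field.
  by rewrite !inE frobV => /eqP->.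
have BN u v : B u (- v) = - B u v by rewrite -mulN1r BZ ?mulN1r // inE frobN frob1.
have BNl u v : B (- v) u = - B v u by rewrite BC BN BC.
have BDl u v w : B (v + w) u = B v u + B w u by rewrite BC BD !(BC u).
have BZl m u v : m \in fixed_field -> B (m * u) v = m * B u v.
  by move=> mK; rewrite BC BZ // BC.
have detN0 u v : u \in fixed_field -> v \in fixed_field ->
    v ^+ 2 - l * u ^+ 2 = 0 -> u = 0 /\ v = 0.
  move=> uK vK /eqP; rewrite subr_eq0; have [->|u0 /eqP h] := eqVneq u 0.
    by rewrite expr0n mulr0 sqrf_eq0 => /eqP.
  have := lNsq (v / u) (KM _ _ vK (KV _ uK)).
  by rewrite expr_div_n h mulfK ?eqxx // expf_neq0.
have indep u v : u \in fixed_field -> v \in fixed_field ->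
    u * x + v * y = 0 -> u = 0 /\ v = 0.
  move=> uK vK h; apply: detN0 => //.
  have ux : u * x = - (v * y) by apply/eqP; rewrite -addr_eq0 h.
  have : B (u * x) (u * x) = B (v * y) (v * y) by rewrite ux BN BNl opprK.
  rewrite !BZl // !BZ // hxy => /eqP; rewrite -subr_eq0.
  have -> : u * (u * (l * B y y)) - v * (v * B y y) =
            - ((v ^+ 2 - l * u ^+ 2) * B y y) by ring.
  rewrite oppr_eq0 mulf_eq0 => /orP[/eqP //|/eqP /B0 [] y00];
  by rewrite y00 eqxx in y0.
have [z zP] : exists z, forall c d, c \in fixed_field -> d \in fixed_field ->
    z != c * x + d * y.
  have : ~~ ([set: F] \subset [set u.1 * x + u.2 * y | u in K2]).
    apply/negP => /subset_leq_card; rewrite cardsT hF.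
    move/leq_trans/(_ (leq_imset_card _ _)); rewrite cK2 leqNgt => /negP[].
    by have := q_gt2; rewrite !expnS expn0 muln1; nia.
  case/subsetPn => z _ zP; exists z => c d cK dK; apply: contra zP => /eqP->.
  by apply/imsetP; exists (c, d); rewrite // /K2 in_setX cK dK.
pose h (t : (F * F) * (F * F)) :=
  t.1.1 * B x z + t.1.2 * B y z - (t.2.1 * B x y + t.2.2 * B y y).
have [[[al be] [ga de]] [tK t0 ht]] :
    exists t, [/\ t \in setX K2 K2, t != ((0, 0), (0, 0)) & h t = 0].
  have /dinjectivePn[u uS [v /andP[/= vu vS] huv]] : ~~ dinjectiveb h (setX K2 K2).
    apply/negP => /dinjectiveP /card_in_imset cS.
    have := max_card (mem (h @: setX K2 K2)); rewrite cS cardsX cK2 hF.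
    by have := q_gt2; rewrite !expnS expn0 muln1; nia.
  move: u v uS vu vS huv => [[u1 u2] [u3 u4]] [[v1 v2] [v3 v4]].
  rewrite /K2 !in_setX /= -!andbA => /and4P[u1K u2K u3K u4K] vu.
  move=> /and4P[v1K v2K v3K v4K] huv.
  exists ((u1 - v1, u2 - v2), (u3 - v3, u4 - v4)); split.
  - by rewrite !in_setX !KD // KN.
  - apply: contra vu => /eqP[/eqP + /eqP + /eqP + /eqP].
    by rewrite !subr_eq0 => /eqP-> /eqP-> /eqP-> /eqP->.
  - by move/eqP: huv; rewrite -subr_eq0 => /eqP <-; rewrite /h /=; ring.
move: tK; rewrite /K2 !in_setX /= -!andbA => /and4P[alK beK gaK deK].
move: ht; rewrite /h /= => /eqP; rewrite subr_eq0 => /eqP ht.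
have [|e0] := eqVneq (be ^+ 2 - l * al ^+ 2) 0.
  move/(detN0 _ _ alK beK) => [al0 be0].
  have : B (ga * x + de * y) y = 0.
    by rewrite BDl !BZl // -ht al0 be0 !mul0r addr0.
  case/B0 => [/(indep _ _ gaK deK)[ga0 de0]|y00]; last by rewrite y00 eqxx in y0.
  by rewrite al0 be0 ga0 de0 eqxx in t0.
(* Cramer's rule for B(al x + be y, c x + d y) = ga B(x, y) + de B(y, y) *)
set e := _ - _ in e0.
have eK : e^-1 \in fixed_field by rewrite KV ?KD ?KN ?KM // expr2 KM.
set c := (be * ga - al * de) * e^-1; set d := (be * de - l * al * ga) * e^-1.
have cK : c \in fixed_field by rewrite KM // KD ?KN ?KM.
have dK : d \in fixed_field by rewrite KM // KD ?KN ?KM.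
have : B (al * x + be * y) (z - (c * x + d * y)) = 0.
  rewrite BD BN BD !BZ // !BDl !BZl // ht hxy (BC y x) /c /d /e; field.
  exact: e0.
case/B0 => [/(indep _ _ alK beK)[al0 be0]|/eqP].
  by rewrite /e al0 be0 expr0n mulr0 subrr eqxx in e0.
by rewrite subr_eq0; apply/negP/zP.
Qed.

End AnisotropicProduct.

(** * Planarity of the trinomial *)

Definition trinomial (a b x : F) : F :=
  frob (frob x) * x + a * frob x * x + b * x ^+ 2.

Definition polar (a b x c : F) : F :=
  frob (frob x) * c + frob (frob c) * x + a * (frob x * c + frob c * x)
  + 2%:R * b * x * c.

Lemma trinomialE a b x :
  x ^+ (q ^ 2 + 1) + a * x ^+ (q + 1) + b * x ^+ 2 = trinomial a b x.
Proof. by rewrite /trinomial /frob !exprD !expr1 -exprM mulnn mulrA. Qed.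

Lemma trinomialD a b x c :
  trinomial a b (x + c) = trinomial a b x + trinomial a b c + polar a b x c.
Proof. by rewrite /trinomial /polar !frobD; ring. Qed.

Lemma polarC a b x c : polar a b x c = polar a b c x.
Proof. by rewrite /polar; ring. Qed.

Lemma polarDr a b x c d : polar a b x (c + d) = polar a b x c + polar a b x d.
Proof. by rewrite /polar !frobD; ring. Qed.

Lemma polarZr a b l x c : l \in fixed_field ->
  polar a b x (l * c) = l * polar a b x c.
Proof. by rewrite inE => /eqP lK; rewrite /polar !frobM !lK; ring. Qed.

Lemma polarxx a b x : polar a b x x = 2%:R * trinomial a b x.
Proof. by rewrite /polar /trinomial; ring. Qed.

Definition anisotropic a b :=
  forall x c, polar a b x c = 0 -> x = 0 \/ c = 0.

Lemma planar_anisotropic a b :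
  planar (fun x : F => x ^+ (q ^ 2 + 1) + a * x ^+ (q + 1) + b * x ^+ 2) <->
  anisotropic a b.
Proof.
have diffE x c : (x + c) ^+ (q ^ 2 + 1) + a * (x + c) ^+ (q + 1)
    + b * (x + c) ^+ 2 - (x ^+ (q ^ 2 + 1) + a * x ^+ (q + 1) + b * x ^+ 2)
    = polar a b x c + trinomial a b c.
  by rewrite !trinomialE trinomialD; ring.
have polar0 c : polar a b 0 c = 0 by rewrite /polar !frob0; ring.
split=> [pl x c xc0 | aniso c c0].
  have [c0|c0] := eqVneq c 0; [by right | left].
  by apply: (bij_inj (pl c c0)); rewrite !diffE xc0 polar0.
apply: injF_bij => x y /=; rewrite !diffE => /addIr/eqP.
rewrite -subr_eq0 !(polarC _ _ _ c) -mulN1r -polarZr; last first.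
  by rewrite inE frobN frob1.
rewrite mulN1r -polarDr => /eqP /aniso[cz|/eqP]; first by rewrite cz eqxx in c0.
by rewrite subr_eq0 => /eqP.
Qed.

(** Choosing one of x and -x for each nonzero x, the map h equal to the
    trinomial on the chosen elements and to l times the trinomial on the others
    is a permutation; raising to a multiple of q - 1 erases l. *)
Lemma sum_trinomial_expf a b m : anisotropic a b -> (q.-1 %| m)%N ->
  \sum_(x : F) trinomial a b x ^+ m = \sum_(x : F) x ^+ m.
Proof.
move=> aniso /dvdnP[d ->].
have t0 x : trinomial a b x = 0 -> x = 0.
  by move=> tx; case: (aniso x x); rewrite ?polarxx ?tx ?mulr0.
have tN x : trinomial a b (- x) = trinomial a b x.
  by rewrite /trinomial !frobN; ring.
have t2 x y : trinomial a b x = trinomial a b y -> x = y \/ x = - y.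
  move=> txy; have : polar a b (x + y) (x - y) = 0.
    transitivity (2%:R * (trinomial a b x - trinomial a b y)).
      by rewrite /polar /trinomial !frobB !frobD; ring.
    by rewrite txy subrr mulr0.
  case/aniso=> /eqP; first by rewrite addr_eq0 => /eqP; right.
  by rewrite subr_eq0 => /eqP; left.
have [l lK lNsq] := exists_nonsquare.
have l0 : l != 0.
  by apply: contraNneq (lNsq 0 _) => [->|]; rewrite ?expr0n ?inE ?frob0.
have tl x y : trinomial a b x = l * trinomial a b y -> y = 0.
  move=> txy; apply: (square_not_proportional (polar a b) _ _ _ _ l x y).
  - exact: polarC.
  - exact: polarDr.
  - by move=> ? ? ? ?; apply: polarZr.
  - exact: aniso.
  - exact: lK.
  - exact: lNsq.
  - by rewrite !polarxx txy; ring.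
(* an arbitrary choice between x and - x, here by enumeration order *)
pose half (x : F) := (enum_rank x < enum_rank (- x))%N.
have halfN x : x != 0 -> half (- x) = ~~ half x.
  rewrite /half opprK -leqNgt [RHS]leq_eqVlt => x0; rewrite orb_idl // => /eqP.
  move/val_inj/enum_rank_inj/esym/eq_opp_eq0 => xx.
  by rewrite xx eqxx in x0.
pose h x := if half x then trinomial a b x else l * trinomial a b x.
have half_inj x y : half x = half y -> trinomial a b x = trinomial a b y -> x = y.
  move=> hxy /t2[] // xy; have [y0|y0] := eqVneq y 0; first by rewrite xy y0 oppr0.
  by move: hxy; rewrite xy halfN //; case: (half y).
have h_inj : injective h.
  move=> x y; rewrite /h; case: ifP => hx; case: ifP => hy.
  - by apply: half_inj; rewrite hx hy.
  - move=> txy; have y0 := tl _ _ txy; rewrite y0 in txy *; apply: t0.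
    by rewrite txy /trinomial frob0; ring.
  - move=> /esym txy; have x0 := tl _ _ txy; rewrite x0 in txy *; apply/esym/t0.
    by rewrite txy /trinomial frob0; ring.
  - by move/(mulfI l0); apply: half_inj; rewrite hx hy.
rewrite [RHS](reindex_inj h_inj) /=; apply: eq_bigr => x _.
rewrite /h; case: ifP => // _; rewrite exprMn -[LHS]mul1r; congr (_ * _).
rewrite mulnC exprM (_ : l ^+ q.-1 = 1) ?expr1n //.
apply: (mulfI l0); rewrite -exprS prednK ?(ltn_trans _ q_gt2) // mulr1.
by move: lK; rewrite inE => /eqP.
Qed.

(** * Sums of forms in the three conjugates *)

(** A point with three coordinates, used both for the conjugates of an element
    and for dehomogenization inside [{poly F}]. *)
Definition pt3 (R : nzRingType) (u v w : R) (i : 'I_3) : R := [:: u; v; w]`_i.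

Lemma prod_pt3 (R : nzRingType) (u v w : R) (m : 'X_{1..3}) :
  \prod_(i < 3) pt3 R u v w i ^+ m i =
  u ^+ m (inord 0) * v ^+ m (inord 1) * w ^+ m (inord 2).
Proof.
rewrite !big_ord_recr big_ord0 /= mul1r /pt3 /=.
by congr (_ ^+ m _ * _ ^+ m _ * _ ^+ m _); apply/val_inj; rewrite /= ?inordK.
Qed.

Lemma mdeg3 (m : 'X_{1..3}) :
  mdeg m = (m (inord 0) + m (inord 1) + m (inord 2))%N.
Proof.
rewrite mdegE !big_ord_recr big_ord0 /= add0n.
by congr (m _ + m _ + m _)%N; apply/val_inj; rewrite /= ?inordK.
Qed.

Lemma sum_frob_monomial i j l : (i + j + l = 4 * q.-1)%N ->
  \sum_(x : F) x ^+ i * frob x ^+ j * frob (frob x) ^+ l =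
  - [|| [&& i == (2 * q).-1, j == q.-2 & l == q.-1],
      [&& i == q.-1, j == (2 * q).-1 & l == q.-2]
    | [&& i == q.-2, j == q.-1 & l == (2 * q).-1]]%N%:R.
Proof.
move=> ijl; rewrite -dvdn_digits // ?q_gt2 // -hF -sum_expf; last first.
  by have := q_gt2; nia.
by apply: eq_bigr => x _; rewrite !exprD -mulnn !exprM.
Qed.

(** Setting X = 0 and Z = 1 in a form of known degree loses nothing about the
    monomials free of X, and the coefficients become univariate. *)
Lemma coef_mmap_yz (g : {mpoly F[3]}) n :
  (mmap polyC (pt3 {poly F} 0 'X 1) g)`_n =
  \sum_(m <- msupp g) g@_m * [&& m (inord 0) == 0 & m (inord 1) == n]%N%:R.
Proof.
rewrite /mmap coef_sum; apply: eq_bigr => m _; rewrite coefCM; congr (_ * _).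
rewrite /mmap1 prod_pt3 expr1n mulr1 expr0n mulr_natl coefMn coefXn.
by rewrite eq_sym; case: eqP; case: eqP.
Qed.

Lemma coef_mmap_xz (g : {mpoly F[3]}) n :
  (mmap polyC (pt3 {poly F} 'X 0 1) g)`_n =
  \sum_(m <- msupp g) g@_m * [&& m (inord 0) == n & m (inord 1) == 0]%N%:R.
Proof.
rewrite /mmap coef_sum; apply: eq_bigr => m _; rewrite coefCM; congr (_ * _).
rewrite /mmap1 prod_pt3 expr1n mulr1 expr0n mulr_natr coefMn coefXn.
by rewrite eq_sym; case: eqP; case: eqP.
Qed.

Lemma sum_weighted_form u0 u1 u2 (g : {mpoly F[3]}) :
    (u0 + u1 + u2 = 2 * q.-1)%N -> g \is (2 * q.-1).-homog ->
  \sum_(x : F) x ^+ u0 * frob x ^+ u1 * frob (frob x) ^+ u2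
    * g.@[pt3 F x (frob x) (frob (frob x))] =
  - \sum_(m <- msupp g) g@_m *
    (let i := u0 + m (inord 0) in let j := u1 + m (inord 1) in
     let l := u2 + m (inord 2) in
     [|| [&& i == (2 * q).-1, j == q.-2 & l == q.-1],
         [&& i == q.-1, j == (2 * q).-1 & l == q.-2]
       | [&& i == q.-2, j == q.-1 & l == (2 * q).-1]])%N%:R.
Proof.
move=> hu /dhomogP hg; under eq_bigr do rewrite mevalE mulr_sumr.
rewrite exchange_big /= raddf_sum /= [LHS]big_seq [RHS]big_seq.
apply: eq_bigr => m /hg; rewrite /= mdeg3 => hm.
rewrite -mulrN -sum_frob_monomial; last by lia.
rewrite mulr_sumr; apply: eq_bigr => x _.
rewrite prod_pt3 !exprD; ring.
Qed.

(** With the weight (XY)^(q-1), the only surviving monomial of g is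
    Y^q Z^(q-2). *)
Lemma sum_weight_xy (g : {mpoly F[3]}) : g \is (2 * q.-1).-homog ->
  \sum_(x : F) x ^+ q.-1 * frob x ^+ q.-1 * frob (frob x) ^+ 0
    * g.@[pt3 F x (frob x) (frob (frob x))] =
  - (mmap polyC (pt3 {poly F} 0 'X 1) g)`_q.
Proof.
move=> hg; have /dhomogP degg := hg; rewrite sum_weighted_form //; last by lia.
rewrite coef_mmap_yz; congr (- _); rewrite [LHS]big_seq [RHS]big_seq.
apply: eq_bigr => m /degg; rewrite /= mdeg3 => hm; congr (_ * _%:R).
have q2 := q_gt2; congr (nat_of_bool _); apply/idP/idP.
  by case/or3P => /and3P[/eqP h0 /eqP h1 /eqP h2]; apply/andP; split; lia.
case/andP => /eqP h0 /eqP h1; apply/or3P/Or32/and3P.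
by split; apply/eqP; lia.
Qed.

(** With the weight X^(q-1) Y^(q-2) Z, the surviving monomials of g are
    X^q Z^(q-2) and Y^(q+1) Z^(q-3). *)
Lemma sum_weight_xyz (g : {mpoly F[3]}) : g \is (2 * q.-1).-homog ->
  \sum_(x : F) x ^+ q.-1 * frob x ^+ q.-2 * frob (frob x) ^+ 1
    * g.@[pt3 F x (frob x) (frob (frob x))] =
  - ((mmap polyC (pt3 {poly F} 'X 0 1) g)`_q +
     (mmap polyC (pt3 {poly F} 0 'X 1) g)`_q.+1).
Proof.
have q2 := q_gt2; move=> hg; have /dhomogP degg := hg.
rewrite sum_weighted_form //; last by lia.
rewrite coef_mmap_yz coef_mmap_xz -big_split; congr (- _).
rewrite [LHS]big_seq [RHS]big_seq.
apply: eq_bigr => m /degg; rewrite /= mdeg3 -mulrDr -natrD => hm.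
congr (_ * _%:R).
have -> (A B : bool) : ~~ (A && B) -> (A + B)%N = (A || B) by case: A; case: B.
  congr (nat_of_bool _); apply/idP/idP.
    case/or3P => /and3P[/eqP h0 /eqP h1 /eqP h2]; apply/orP.
    - by left; apply/andP; split; lia.
    - by right; apply/andP; split; lia.
    - by left; apply/andP; split; lia.
  case/orP => /andP[/eqP h0 /eqP h1]; apply/or3P; [apply: Or31|apply: Or32];
    by apply/and3P; split; apply/eqP; lia.
by apply/negP => /andP[/andP[/eqP h0 _] /andP[/eqP h1 _]]; lia.
Qed.

(** * Geometric sums in characteristic p *)

Lemma sum_ord_last (R : nzRingType) (f : nat -> R) n : (0 < n)%N ->
  \sum_(i < n) f i = \sum_(i < n.-1) f i + f n.-1.
Proof. by case: n => // n _; rewrite big_ord_recr. Qed.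

Lemma sum_ord_first (R : nzRingType) (f : nat -> R) n : (0 < n)%N ->
  \sum_(i < n) f i = f 0%N + \sum_(i < n.-1) f i.+1.
Proof. by case: n => // n _; rewrite big_ord_recl. Qed.

Lemma frobE_pchar (R : idomainType) (y : R) : p \in [pchar R] ->
  (y - 1) ^+ q = y ^+ q - 1.
Proof.
move=> pR; apply/eqP; rewrite eq_sym subr_eq -[X in _ + X](expr1n _ q).
rewrite -exprDn_pchar ?subrK //.
by rewrite (eq_pnat _ (pcharf_eq pR)) hq pnatX pnat_id.
Qed.

Lemma geom_sum_pchar (R : idomainType) (y : R) : p \in [pchar R] -> y != 1 ->
  \sum_(i < q) y ^+ i = (1 - y) ^+ q.-1.
Proof.
move=> pR y1; have q2 := q_gt2.
have -> : (1 - y) ^+ q.-1 = (y - 1) ^+ q.-1.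
  rewrite -opprB exprNn -signr_odd (_ : odd q.-1 = false) ?mul1r //.
  by have := q_odd; lia.
have y10 : y - 1 != 0 by rewrite subr_eq0.
apply: (mulfI y10); rewrite -subrX1 -exprS prednK ?frobE_pchar //; lia.
Qed.

(** The derivative of the geometric sum, multiplied by 1 - y, telescopes. *)
Lemma mul_deriv_geom_sum (R : comNzRingType) (y : R) n :
  (1 - y) * (\sum_(i < n) i.+1%:R * y ^+ i) =
  \sum_(i < n) y ^+ i - n%:R * y ^+ n.
Proof.
elim: n => [|n IH]; first by rewrite !big_ord0 mulr0 mul0r subr0.
rewrite !big_ord_recr /= mulrDr IH -natr1 exprS; ring.
Qed.

Lemma deriv_geom_sum_pchar (R : idomainType) (y : R) :
    p \in [pchar R] -> y != 1 ->
  \sum_(i < q.-1) i.+1%:R * y ^+ i = (1 - y) ^+ q.-2.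
Proof.
move=> pR y1; have q2 := q_gt2.
have y10 : 1 - y != 0 by rewrite subr_eq0 eq_sym.
apply: (mulfI y10); rewrite mul_deriv_geom_sum -exprS.
have -> : q.-2.+1 = q.-1 by lia.
rewrite -(geom_sum_pchar _ _ pR y1).
rewrite (sum_ord_last _ (fun i => y ^+ i) q); last lia.
congr (_ + _).
have /eqP : q.-1.+1%:R = 0 :> R.
  apply/eqP; rewrite prednK; last lia.
  by rewrite -(dvdn_pcharf pR) hq -(prednK hk) expnS dvdn_mulr.
by rewrite -natr1 addr_eq0 => /eqP ->; rewrite mulN1r opprK.
Qed.

Definition dgeom (w : F) : F := \sum_(i < q.-1) i.+1%:R * w ^+ i.

Lemma dgeom_fixed w : w \in fixed_field -> w != 1 -> (1 - w) * dgeom w = 1.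
Proof.
rewrite inE => /eqP wK w1; have q2 := q_gt2.
have w10 : 1 - w != 0 by rewrite subr_eq0 eq_sym.
rewrite /dgeom deriv_geom_sum_pchar ?p_pchar // -exprS.
apply: (mulfI w10); rewrite -exprS mulr1.
have -> : q.-2.+2 = q by lia.
by rewrite -/(frob _) frobB frob1 wK.
Qed.

Lemma dgeom1 : dgeom 1 = 0.
Proof.
have q2 := q_gt2.
have gauss : (2 * \sum_(i < q) i = q * q.-1)%N.
  rewrite -(big_mkord xpredT id) bin2_sum bin2 mul2n even_halfK //.
  by rewrite oddM; have := q_odd; lia.
have : \sum_(i < q) i%:R = 0 :> F.
  apply: (mulfI two_neq0).
  by rewrite mulr0 -natr_sum -natrM gauss natrM natq_eq0 mul0r.
rewrite (sum_ord_first _ (fun i => i%:R)); last lia.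
rewrite mulr0n add0r => h.
by rewrite -[RHS]h /dgeom; apply: eq_bigr => i _; rewrite expr1n mulr1.
Qed.

Lemma coef_lin_expq1 c i :
  ((1 - c *: 'X : {poly F}) ^+ q.-1)`_i = if (i < q)%N then c ^+ i else 0.
Proof.
have pP : p \in [pchar {poly F}] by rewrite pchar_poly p_pchar.
have c1 : c *: 'X != 1 :> {poly F}.
  apply/eqP => /(congr1 (fun P : {poly F} => P`_0)).
  by rewrite coefZ coefX mulr0 coef1 => /esym/eqP; rewrite oner_eq0.
rewrite -(geom_sum_pchar _ _ pP c1) -coef_poly poly_def.
by congr ((polyseq _)`_i); apply: eq_bigr => j _; rewrite exprZn.
Qed.

Lemma coef_lin_expq2 c i :
  ((1 - c *: 'X : {poly F}) ^+ q.-2)`_i =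
  if (i < q.-1)%N then i.+1%:R * c ^+ i else 0.
Proof.
have pP : p \in [pchar {poly F}] by rewrite pchar_poly p_pchar.
have c1 : c *: 'X != 1 :> {poly F}.
  apply/eqP => /(congr1 (fun P : {poly F} => P`_0)).
  by rewrite coefZ coefX mulr0 coef1 => /esym/eqP; rewrite oner_eq0.
rewrite -(deriv_geom_sum_pchar _ _ pP c1).
rewrite -(coef_poly _ (fun i => i.+1%:R * c ^+ i)) poly_def.
congr ((polyseq _)`_i); apply: eq_bigr => j _.
by rewrite exprZn -scalerA scaler_nat mulr_natl.
Qed.

(** The factors are truncations of a geometric series in c 'X and of a geometric
    series in c w 'X (below, its derivative), so a coefficient of the product
    is, up to a power of c, a partial sum of the series in w.  In the degrees
    q - 1, q and q + 1 the truncation removes at most the first two terms. *)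
Lemma coef_prod_q1q1 c w :
  ((1 - c *: 'X : {poly F}) ^+ q.-1 * (1 - (c * w) *: 'X) ^+ q.-1)`_q =
  c ^+ q * (\sum_(i < q) w ^+ i - 1).
Proof.
have q2 := q_gt2; rewrite mulrC coefM.
rewrite (sum_ord_last _ (fun i => ((1 - (c * w) *: 'X : {poly F}) ^+ q.-1)`_i
  * ((1 - c *: 'X : {poly F}) ^+ q.-1)`_(q - i))) //= coef_lin_expq1 ltnn mul0r addr0.
rewrite (sum_ord_first _ (fun i => w ^+ i)); last lia.
rewrite (sum_ord_first _ (fun i => ((1 - (c * w) *: 'X : {poly F}) ^+ q.-1)`_i
  * ((1 - c *: 'X : {poly F}) ^+ q.-1)`_(q - i))); last lia.
rewrite !coef_lin_expq1 subn0 ltnn mulr0 add0r expr0 addrAC subrr add0r mulr_sumr.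
apply: eq_bigr => i _; have hi := ltn_ord i; rewrite !coef_lin_expq1.
rewrite !ifT; try lia.
rewrite exprMn mulrAC -exprD; congr (_ ^+ _ * _); lia.
Qed.

Lemma coef_prod_q1q2 c w m :
  ((1 - c *: 'X : {poly F}) ^+ q.-1 * (1 - (c * w) *: 'X) ^+ q.-2)`_m =
  c ^+ m * \sum_(i < m.+1)
    (if (i < q.-1)%N && (m - i < q)%N then i.+1%:R * w ^+ i else 0).
Proof.
rewrite mulrC coefM mulr_sumr; apply: eq_bigr => i _; have hi := ltn_ord i.
rewrite coef_lin_expq1 coef_lin_expq2; case: ifP => h1; last by rewrite mul0r mulr0.
case: ifP => h2; last by rewrite !mulr0.
have -> : c ^+ m = c ^+ i * c ^+ (m - i) by rewrite -exprD subnKC // -ltnS.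
rewrite exprMn /=; move: (c ^+ i) (c ^+ _) => u v; ring.
Qed.

Lemma coef_prod_q1q2_pred c w :
  ((1 - c *: 'X : {poly F}) ^+ q.-1 * (1 - (c * w) *: 'X) ^+ q.-2)`_q.-1 =
  c ^+ q.-1 * dgeom w.
Proof.
have q2 := q_gt2; rewrite coef_prod_q1q2; congr (_ * _).
rewrite big_ord_recr /= ltnn addr0; apply: eq_bigr => i _.
by have hi := ltn_ord i; rewrite ifT //; lia.
Qed.

Lemma coef_prod_q1q2_q c w :
  ((1 - c *: 'X : {poly F}) ^+ q.-1 * (1 - (c * w) *: 'X) ^+ q.-2)`_q =
  c ^+ q * (dgeom w - 1).
Proof.
have q2 := q_gt2; rewrite coef_prod_q1q2; congr (_ * _).
rewrite big_ord_recr /= ifF ?addr0; last lia.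
pose f i := if (i < q.-1)%N && (q - i < q)%N then i.+1%:R * w ^+ i else 0 : F.
rewrite (sum_ord_last _ f); last lia.
rewrite {2}/f ltnn addr0 (sum_ord_first _ f); last lia.
rewrite /dgeom (sum_ord_first _ (fun i => i.+1%:R * w ^+ i)); last lia.
rewrite expr0 mulr1 addrAC subrr add0r {1}/f subn0 ltnn andbF add0r.
by apply: eq_bigr => i _; have hi := ltn_ord i; rewrite /f ifT //; lia.
Qed.

Lemma coef_prod_q1q2_succ c w :
  ((1 - c *: 'X : {poly F}) ^+ q.-1 * (1 - (c * w) *: 'X) ^+ q.-2)`_q.+1 =
  c ^+ q.+1 * (dgeom w - 1 - 2%:R * w).
Proof.
have q2 := q_gt2; rewrite coef_prod_q1q2; congr (_ * _).
rewrite !big_ord_recr /= !ifF ?addr0; try lia.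
pose f i := if (i < q.-1)%N && (q.+1 - i < q)%N then i.+1%:R * w ^+ i else 0 : F.
rewrite (sum_ord_last _ f); last lia.
rewrite {2}/f ltnn addr0 (sum_ord_first _ f); last lia.
rewrite /dgeom (sum_ord_first _ (fun i => i.+1%:R * w ^+ i)); last lia.
rewrite expr0 mulr1 [_ - 1]addrAC subrr add0r {1}/f ifF ?add0r; last lia.
rewrite (sum_ord_first _ (fun i => f i.+1)); last lia.
rewrite (sum_ord_first _ (fun i => i.+2%:R * w ^+ i.+1)); last lia.
rewrite expr1 addrAC subrr add0r {1}/f ifF ?add0r; last lia.
by apply: eq_bigr => i _; have hi := ltn_ord i; rewrite /f ifT //; lia.
Qed.

(** * Two coefficient identities *)

Definition lform (u v w : F) : {mpoly F[3]} :=
  u *: 'X_(inord 0) + v *: 'X_(inord 1) + w *: 'X_(inord 2).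

Lemma lform_homog u v w : lform u v w \is 1.-homog.
Proof.
by rewrite /lform !rpredD ?rpredZ // dhomogX /= mdeg1.
Qed.

Lemma lform_exp_homog u v w n : lform u v w ^+ n \is n.-homog.
Proof. by have := dhomogMn n (lform_homog u v w); rewrite mul1n. Qed.

Lemma meval_lform u v w x y z :
  (lform u v w).@[pt3 F x y z] = u * x + v * y + w * z.
Proof. by rewrite /lform !mevalD !mevalZ !mevalXU /pt3 !inordK. Qed.

Lemma mmap_lform u v w (x y z : {poly F}) :
  mmap polyC (pt3 {poly F} x y z) (lform u v w) = u *: x + v *: y + w *: z.
Proof.
by rewrite /lform !mmapD !mmapZ !mmapX !mmap1U /pt3 !inordK // !mul_polyC.
Qed.

Lemma frob_trinomial a b x : frob (trinomial a b x) =
  frob x * (lform 1 (frob b) (frob a)).@[pt3 F x (frob x) (frob (frob x))].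
Proof.
by rewrite meval_lform /trinomial expr2 !frobD !frobM frob3; ring.
Qed.

Lemma trinomial_lform a b x : trinomial a b x =
  x * (lform b a 1).@[pt3 F x (frob x) (frob (frob x))].
Proof. by rewrite meval_lform /trinomial; ring. Qed.

Lemma frob2_trinomial a b x : frob (frob (trinomial a b x)) =
  frob (frob x) * (lform (frob (frob a)) 1 (frob (frob b))).@[
    pt3 F x (frob x) (frob (frob x))].
Proof.
by rewrite meval_lform /trinomial expr2 !frobD !frobM !frob3; ring.
Qed.

Lemma sum_expf_lt m : (0 < m < (q ^ 3).-1)%N -> \sum_(x : F) x ^+ m = 0.
Proof.
case/andP=> m0 mq; rewrite sum_expf // hF gtnNdvd ?oppr0 //.
Qed.

(** The left side is minus the power sum of the trinomial of exponent
    (q - 1) + (q - 1) q. *)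
Lemma anisotropic_coef_q1q1 a b : anisotropic a b ->
  ((a *: 'X + 1 : {poly F}) ^+ q.-1 *
   (frob b *: 'X + (frob a)%:P) ^+ q.-1)`_q = 0.
Proof.
move=> aniso; have q2 := q_gt2.
pose g := lform b a 1 ^+ q.-1 * lform 1 (frob b) (frob a) ^+ q.-1.
have hg : g \is (2 * q.-1).-homog.
  by rewrite mul2n -addnn dhomogM // lform_exp_homog.
transitivity (mmap polyC (pt3 {poly F} 0 'X 1) g)`_q.
  rewrite /g rmorphM !rmorphXn /= !mmap_lform !scaler0 !add0r !scale1r.
  by rewrite alg_polyC /frob !rmorphXn.
apply/eqP; rewrite -oppr_eq0 -sum_weight_xy //.
rewrite -[X in _ == X](sum_expf_lt (q.-1 + q * q.-1)); last first.
  by rewrite !expnS expn0; nia.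
rewrite -(sum_trinomial_expf _ _ _ aniso); last by rewrite dvdn_add ?dvdn_mull.
apply/eqP/eq_bigr => x _; rewrite exprD exprM -/(frob _) frob_trinomial.
rewrite {1}trinomial_lform /g mevalM !rmorphXn /= !exprMn expr0; ring.
Qed.

(** The left side is minus the power sum of the trinomial of exponent
    (q - 1) + (q - 2) q + q^2 = (q - 1)(2 q + 1). *)
Lemma anisotropic_coef_q1q2 a b : anisotropic a b ->
  ((b *: 'X + 1 : {poly F}) ^+ q.-1 * ('X + (frob a)%:P) ^+ q.-2
   * (frob (frob a) *: 'X + (frob (frob b))%:P))`_q +
  ((a *: 'X + 1 : {poly F}) ^+ q.-1 *
   (frob b *: 'X + (frob a)%:P) ^+ q.-2 * ('X + (frob (frob b))%:P))`_q.+1 = 0.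
Proof.
move=> aniso; have q2 := q_gt2.
pose g := lform b a 1 ^+ q.-1 * lform 1 (frob b) (frob a) ^+ q.-2
  * lform (frob (frob a)) 1 (frob (frob b)).
have hg : g \is (2 * q.-1).-homog.
  have -> : (2 * q.-1 = q.-1 + q.-2 + 1)%N by lia.
  by rewrite !dhomogM ?lform_exp_homog ?lform_homog.
transitivity ((mmap polyC (pt3 {poly F} 'X 0 1) g)`_q
    + (mmap polyC (pt3 {poly F} 0 'X 1) g)`_q.+1).
  rewrite /g !rmorphM !rmorphXn /= !mmap_lform !scaler0 !add0r !addr0 !scale1r.
  by rewrite !alg_polyC /frob !rmorphXn.
apply/eqP; rewrite -oppr_eq0 -sum_weight_xyz //.
rewrite -[X in _ == X](sum_expf_lt (q.-1 + q * q.-2 + q * q)); last first.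
  by rewrite !expnS expn0; nia.
rewrite -(sum_trinomial_expf _ _ _ aniso); last first.
  by apply/dvdnP; exists (2 * q + 1)%N; nia.
apply/eqP/eq_bigr => x _; rewrite !exprD !exprM -!/(frob _) frob2_trinomial.
rewrite frob_trinomial {1}trinomial_lform /g !mevalM !rmorphXn /= !exprMn expr1.
ring.
Qed.

(** * Sufficiency *)

(** With M the linear map m of this case, a zero (x, c) of B satisfies
    P = a'^2 P'' for P = M x * M c; comparing norms gives
    P = 0, and M is injective. *)
Lemma anisotropic_field_type a b :
    norm3 q a - 2%:R * a * frob (frob b) + 1 = 0 -> norm3 q a ^+ 2 <> 1 ->
  anisotropic a b.
Proof.
move=> hab hN; set n := norm3 q a in hab hN.
have nE : n = a * frob a * frob (frob a) by rewrite /n norm3E.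
have n1 : 1 - n != 0 by apply: contra_not_neq hN => /subr0_eq <-; rewrite expr1n.
have hb : 2%:R * frob a * b = n + 1.
  have := congr1 frob hab.
  rewrite frobD frobB !frobM frob3 frob_nat frob1 frob0 /n frob_norm3 -/n => h.
  by apply/eqP; rewrite -subr_eq0 -oppr_eq0; apply/eqP; rewrite -[RHS]h; ring.
pose M x := x + a * frob a * frob x + frob a * frob (frob x).
have M0 x : M x = 0 -> x = 0.
  move=> Mx; apply: (mulfI n1); rewrite mulr0.
  transitivity (M x - frob a * frob (frob (M x))); last by rewrite Mx !frob0; ring.
  by rewrite /M !frobD !frobM !frob3 nE; ring.
move=> x c xc0; set P := M x * M c.
have PE : P = (frob a * frob a) * frob (frob P).
  apply/eqP; rewrite -subr_eq0; apply/eqP.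
  transitivity ((1 - n) * frob a * polar a b x c); last by rewrite xc0 mulr0.
  transitivity ((1 - n) * (frob a * (frob (frob x) * c + frob (frob c) * x +
     a * (frob x * c + frob c * x)) + (2%:R * frob a * b) * x * c)).
    by rewrite hb /P /M !frobM !frobD !frobM !frob3 nE; ring.
  by rewrite /polar; ring.
have [P0|P0] := eqVneq P 0.
  by have /eqP := P0; rewrite mulf_eq0 => /orP[] /eqP/M0 ->; [left|right].
have P1 : norm3 q P != 0 by rewrite norm3_eq0.
case: hN; apply: (mulIf P1); rewrite mul1r [in RHS]PE.
by rewrite [RHS]norm3M norm3M !norm3_frob -/n expr2.
Qed.

(** With M the linear map m of this case, a zero (x, c) of B satisfies
    b' P = P' for P the polarization of m m''; comparing norms gives
    P = 0.  If M x and M c were nonzero, their quotient t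
    would satisfy t'' = - t, whence t = - t after applying Frobenius. *)
Lemma anisotropic_twisted_type b : norm3 q b <> 1 -> anisotropic (frob b * b) b.
Proof.
move=> hN; set n := norm3 q b in hN.
have nE : n = b * frob b * frob (frob b) by rewrite /n norm3E.
have n1 : n - 1 != 0 by rewrite subr_eq0; apply/eqP.
pose M x := frob (frob x) + b * x + b * frob b * frob x.
have M0 x : M x = 0 -> x = 0.
  move=> Mx; apply: (mulfI n1); rewrite mulr0.
  transitivity (frob b * frob (frob (M x)) - frob (M x)); last first.
    by rewrite Mx !frob0; ring.
  by rewrite /M !frobD !frobM !frob3 nE; ring.
move=> x c xc0; set P := M x * frob (frob (M c)) + frob (frob (M x)) * M c.
have PE : frob b * P = frob P.
  apply/eqP; rewrite -subr_eq0; apply/eqP.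
  transitivity ((n - 1) * polar (frob b * b) b x c); last by rewrite xc0 mulr0.
  by rewrite /P /M /polar !(frobD, frobM, frob3) nE; ring.
have P0 : P = 0.
  apply/eqP/negPn/negP => P0; apply: hN.
  have P1 : norm3 q P != 0 by rewrite norm3_eq0.
  by apply: (mulIf P1); rewrite mul1r -[RHS]norm3_frob -PE norm3M norm3_frob.
have [/M0->|Mx0] := eqVneq (M x) 0; [by left|].
have [/M0->|Mc0] := eqVneq (M c) 0; [by right|].
pose t := M x / M c.
have t2 : frob (frob t) = - t.
  have Mc2 : frob (frob (M c)) != 0 by rewrite !frob_eq0.
  rewrite /t !frobM !frobV; apply/eqP; rewrite -subr_eq0 opprK.
  rewrite addf_div // addrC mulrC; move: P0; rewrite /P.
  by rewrite [M x * _]mulrC addrC => ->; rewrite mulr0.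
have t1 : frob t = - t by rewrite -[LHS]opprK -frobN -t2 frob3.
have /eq_opp_eq0/eqP : t = - t by rewrite -t2 t1 frobN t1 opprK.
by rewrite mulf_eq0 invr_eq0 (negPf Mx0) (negPf Mc0).
Qed.

(** * Necessity *)

Lemma coef_mul_lin (P : {poly F}) u v n :
  (P * (u *: 'X + v%:P))`_n.+1 = u * P`_n + v * P`_n.+1.
Proof. by rewrite mulrDr coefD -scalerAr coefZ coefMX coefMC /= [v * _]mulrC. Qed.

Lemma lin_polyE u v w : v * w = u ->
  u *: 'X + v%:P = v *: (1 - (- w) *: 'X) :> {poly F}.
Proof.
by move=> <-; rewrite scalerBr scalerA mulrN scaleNr opprK addrC alg_polyC.
Qed.

(** The coefficient of degree q is, up to a unit, the geometric sum of w minus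
    1.  For w = 1 this is -1; otherwise the sum is (1 - w)^(q-1), and it equals
    1 exactly when w lies in the fixed field. *)
Lemma anisotropic_ratio a b (w := frob b / (a * frob a)) :
    a != 0 -> anisotropic a b ->
  w \in fixed_field /\ w != 1.
Proof.
move=> a0 /anisotropic_coef_q1q1; have a10 : frob a != 0 by rewrite frob_eq0.
have q2 := q_gt2.
have -> : a *: 'X + 1 = 1 - (- a) *: 'X :> {poly F} by rewrite scaleNr opprK addrC.
rewrite (lin_polyE _ _ (a * w)); last by rewrite /w; field; rewrite a0 a10.
rewrite exprZn -scalerAr coefZ -mulNr coef_prod_q1q1 => /eqP.
rewrite !mulf_eq0 !expf_eq0 oppr_eq0 ?(negPf a10) (negPf a0) !andbF /= subr_eq0.
move=> /eqP hw; have w1 : w != 1.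
  apply/eqP => w1; have := hw; rewrite w1; under eq_bigr do rewrite expr1n.
  by rewrite sumr_const card_ord natq_eq0 => /esym/eqP; rewrite oner_eq0.
split=> //; rewrite (geom_sum_pchar _ _ p_pchar w1) in hw.
have : frob (1 - w) = 1 - w.
  by rewrite /frob -{1}(prednK (_ : 0 < q)%N) ?exprS ?hw ?mulr1 //; lia.
by rewrite frobB frob1 inE => /addrI/oppr_inj ->.
Qed.

(** The second coefficient identity, divided by (a^q)^(q-2). *)
Lemma anisotropic_relation a b (w := frob b / (a * frob a))
    (v := (b * frob a)^-1) :
    a != 0 -> b != 0 -> anisotropic a b ->
  frob (frob a) * (frob b / b) * dgeom v - frob (frob b) * frob b * (dgeom v - 1)
  - frob a * (dgeom w - 1)
  + frob (frob b) * a * frob a * (dgeom w - 1 - 2%:R * w) = 0.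
Proof.
move=> a0 b0 /anisotropic_coef_q1q2; have a10 : frob a != 0 by rewrite frob_eq0.
have q2 := q_gt2.
have linE u : u *: 'X + 1 = 1 - (- u) *: 'X :> {poly F}.
  by rewrite scaleNr opprK addrC.
have monicE u : 'X + u%:P = 1 *: 'X + u%:P :> {poly F} by rewrite scale1r.
rewrite !linE (monicE (frob a)) (monicE (frob (frob b))).
rewrite (lin_polyE (frob b) (frob a) (a * w)); last by rewrite /w; field; rewrite a0 a10.
rewrite (lin_polyE 1 (frob a) (b * v)); last by rewrite /v; field; rewrite b0 a10.
rewrite !exprZn -!scalerAr -!scalerAl !coefZ -!mulNr.
have coef_q (P : {poly F}) u z : (P * (u *: 'X + z%:P))`_q = u * P`_q.-1 + z * P`_q.
  by rewrite -{1}(prednK (_ : 0 < q)%N) ?coef_mul_lin ?prednK //; lia.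
rewrite coef_mul_lin coef_q coef_prod_q1q2_pred !coef_prod_q1q2_q coef_prod_q1q2_succ.
have expq u : u != 0 -> (- u) ^+ q.-1 = frob u / u.
  move=> u0; have nu0 : - u != 0 by rewrite oppr_eq0.
  apply: (mulfI nu0); rewrite -exprS prednK; last lia.
  by rewrite -/(frob _) frobN; field.
rewrite expq // exprS -!/(frob _) !frobN -mulrDr => /eqP.
rewrite mulf_eq0 expf_eq0 (negPf a10) andbF /= => /eqP h.
rewrite -[RHS]h; ring.
Qed.

(** Replacing a, b and its conjugates by their values in terms of s and w leaves
    a relation between scalars of the fixed field. *)
Lemma relation_normalized (a a1 a2 b b1 b2 s w dv dw : F) :
    a1 != 0 -> a2 != 0 -> s != 0 -> w != 0 -> a = s / (w * a1 * a2) ->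
    b = s / a1 -> b1 = s / a2 -> b2 = s / a ->
  a2 * (b1 / b) * dv - b2 * b1 * (dv - 1) - a1 * (dw - 1)
  + b2 * a * a1 * (dw - 1 - 2%:R * w) =
  a1 * (dv - s * w * (dv - 1) - (dw - 1) + s * (dw - 1 - 2%:R * w)).
Proof.
move=> a10 a20 s0 w0 -> -> -> ->; field.
by rewrite a10 a20 s0 w0.
Qed.

Lemma anisotropic_necessary a b : a != 0 -> b != 0 -> anisotropic a b ->
  (a = frob b * b /\ norm3 q b <> 1) \/
  (norm3 q a - 2%:R * a * frob (frob b) + 1 = 0 /\ norm3 q a ^+ 2 <> 1).
Proof.
move=> a0 b0 aniso; have [wK w1] := anisotropic_ratio a b a0 aniso.
have := anisotropic_relation a b a0 b0 aniso.
set w := frob b / (a * frob a) in wK w1 *.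
set v := (b * frob a)^-1; set dv := dgeom v.
set dw := dgeom w.
have a10 : frob a != 0 by rewrite frob_eq0.
have a20 : frob (frob a) != 0 by rewrite !frob_eq0.
have b10 : frob b != 0 by rewrite frob_eq0.
have b20 : frob (frob b) != 0 by rewrite !frob_eq0.
pose s := b * frob a.
have s0 : s != 0 by rewrite mulf_neq0.
have w0 : w != 0 by rewrite mulf_neq0 ?invr_eq0 ?mulf_neq0.
have e1 : frob (frob b) * a = frob b * frob (frob a).
  move: wK; rewrite inE frobM frobV frobM => /eqP h.
  transitivity (frob (frob b) / (frob a * frob (frob a))
                * (a * frob a * frob (frob a))).
    by field; rewrite a10 a20.
  by rewrite h /w; field; rewrite a0 a10.
have e2 : s = frob (frob b) * a.
  by have := congr1 frob e1; rewrite !frobM !frob3.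
have sK : frob s = s by rewrite /s frobM -e1 -e2.
have vK : v \in fixed_field by rewrite inE /v frobV -/s sK.
have ws : w * norm3 q a = s.
  by rewrite norm3E e2 e1 /w; field; rewrite a0 a10.
have wdw := dgeom_fixed _ wK w1; rewrite -/dw in wdw.
have bE : b = s / frob a by rewrite /s mulfK.
have b1E : frob b = s / frob (frob a) by rewrite e2 e1 mulfK.
have b2E : frob (frob b) = s / a by rewrite e2 mulfK.
have aE : a = s / (w * frob a * frob (frob a)).
  by rewrite -ws norm3E; field; rewrite w0 a10 a20.
have vE : v = s^-1 by [].
rewrite (relation_normalized _ _ _ _ _ _ _ _ _ _ a10 a20 s0 w0 aE bE b1E b2E) => /eqP.
rewrite mulf_eq0 (negPf a10) /= => /eqP rel.
have [v1|v1] := eqVneq v 1.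
  have s1 : s = 1 by apply: invr_inj; rewrite invr1 -vE.
  case/eqP: w0; apply: oppr_inj; rewrite oppr0 -[RHS]rel /dv v1 dgeom1 s1; ring.
have vdv := dgeom_fixed _ vK v1; rewrite -/dv in vdv.
(* v = 1 / s, so the value of dgeom v can be read off after clearing s *)
have sdv : (s - 1) * dv = s.
  by rewrite -[RHS]mulr1 -[X in _ = _ * X]vdv vE; field.
have s1 : s != 1 by apply: contraNneq v1 => s1; rewrite vE s1 invr1.
have : (s * w - 1) * ((2%:R * s - 1) * w - s) = 0.
  transitivity ((dv - s * w * (dv - 1) - (dw - 1) + s * (dw - 1 - 2%:R * w))
                  * ((s - 1) * (1 - w))
                - ((s - 1) * dv - s) * ((1 - s * w) * (1 - w))
                - ((1 - w) * dw - 1) * (s - 1) ^+ 2); first by ring.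
  by rewrite rel sdv wdw !subrr !mul0r !subr0.
have mulw0 x : x * w = 0 -> x = 0.
  by move/eqP; rewrite mulf_eq0 (negPf w0) orbF => /eqP.
move/eqP; rewrite mulf_eq0 => /orP[] /eqP h; [left | right].
  have ns : norm3 q a = s ^+ 2.
    apply/esym/subr0_eq/mulw0.
    transitivity (s * (s * w - 1) + (s - w * norm3 q a)); first by ring.
    by rewrite h ws mulr0 subrr addr0.
  have ab : a = frob b * b.
    have a12 : frob a * frob (frob a) != 0 by rewrite mulf_neq0.
    apply: (mulIf a12); rewrite mulrA -norm3E ns expr2 {1}e2 e1 /s; ring.
  split=> // bn; case/eqP: s1; rewrite -bn norm3E {1}e2 ab; ring.
have ns : norm3 q a = 2%:R * s - 1.
  apply/esym/subr0_eq/mulw0.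
  transitivity ((2%:R * s - 1) * w - s + (s - w * norm3 q a)); first by ring.
  by rewrite h ws subrr addr0.
split; first by rewrite -mulrA [a * _]mulrC -e2 ns; ring.
move/eqP; rewrite -subr_eq0 ns.
have -> : (2%:R * s - 1) ^+ 2 - 1 = 2%:R * 2%:R * s * (s - 1) by ring.
by apply/negP; rewrite !mulf_neq0 ?two_neq0 // subr_eq0.
Qed.

End CubicExtension.

Theorem theorem4 (p k q : nat) (F : finFieldType) (a b : F)
    (hp : prime p) (hodd : odd p) (hk : (0 < k)%N) (hq : q = (p ^ k)%N)
    (hF : #|F| = (q ^ 3)%N) (ha : a != 0) (hb : b != 0) :
  planar (fun x : F => x ^+ (q ^ 2 + 1) + a * x ^+ (q + 1) + b * x ^+ 2) <->
  (a = b ^+ (q + 1) /\ norm3 q b <> 1) \/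
  (norm3 q a - 2%:R * a * b ^+ (q ^ 2) + 1 = 0 /\ norm3 q a ^+ 2 <> 1).
Proof.
have -> : b ^+ (q + 1) = frob F q b * b by rewrite exprD expr1.
have -> : b ^+ (q ^ 2) = frob F q (frob F q b) by rewrite -mulnn exprM.
rewrite (planar_anisotropic F p k q hp hodd hk hq hF).
split; first exact: (anisotropic_necessary F p k q hp hodd hk hq hF).
case=> [[-> hN]|[h hN]]; first exact: (anisotropic_twisted_type F p k q).
exact: (anisotropic_field_type F p k q).
Qed.
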